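(* For $u\in\mathbb R^r$ let $\lambda(u)=\operatorname{dist}\left(u,\bigcup_{\{j\in[V]:u\notin\mathcal C_j\}}\mathcal C_j\right)$ and, for $u\in\mathcal C_i$, $\zeta(u)=\frac12\operatorname{dist}(u,\operatorname{bd}(\mathcal C_i))$. Consider the certification algorithm described in the context, run with input $u_\varepsilon\in\mathbb R^r$ and $\eta_0>0$, and let $\bar u$ be the point it constructs in step 1. Then the algorithm correctly identifies whether $\bar u$ is a local minimizer of $g_0$ or not with probability $1$, and: (1) if $\bar u\in\operatorname{int}(\mathcal C_i)$ for some $i \in [V]$, the while loop terminates within $\max\{0,\lceil\log_2(\eta_0/\zeta(\bar u))\rceil\}+1$ iterations; (2) if $\bar u\in\operatorname{bd}(\mathcal C_i)$ for some $i\in[V]$, the while loop terminates within $\max\{0,\lceil\log_2(\eta_0/\lambda(\bar u))\rceil\}+2$ iterations. Furthermore, for any input $u_\varepsilon$, the algorithm terminates after at most $$\max_{i\in[V]}\left\{\max\left\{0,\max_{u\in S\cap\operatorname{int}(\mathcal C_i)}\lceil\log_2(\eta_0/\zeta(u))\rceil\right\}+1,\ \max\left\{0,\max_{u\in S\cap\operatorname{bd}(\mathcal C_i)}\lceil\log_2(\eta_0/\lambda(u))\rceil\right\}+2\right\}<\infty$$ iterations of the while loop, where $S$ is the set of Clarke critical points of $g_0$, which has finite cardinality.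
   Context: Let $\mathrm A\in\mathbb R^{m\times n}$, $b\in\mathbb R^m$, $c\in\mathbb R^n$, $\mathcal K=\{x\in\mathbb R^n:\mathrm Ax=b,\ x\ge 0\}$, and let $\mathrm M\in\mathbb R^{n\times n}$ be symmetric positive semidefinite, written $\mathrm M=\mathrm B^{\intercal}\mathrm B$ with $\mathrm B\in\mathbb R^{r\times n}$, $r\le n$. Standing assumption: $\mathcal K$ is nonempty and bounded, and $x\mapsto-\frac12x^{\intercal}\mathrm Mx+c^{\intercal}x$ is nonconstant on $\mathcal K$. $\{v^{(i)}\}_{i=1}^V$ is the set of vertices of $\mathcal K$, $[V]=\{1,\dots,V\}$, and $\mathcal C_i=\{u\in\mathbb R^r:(c-\mathrm B^{\intercal}u)^{\intercal}v^{(i)}\le(c-\mathrm B^{\intercal}u)^{\intercal}v^{(j)}\text{ for every }j\ne i\}$. $g_0(u)=\frac12\|u\|^2+\min_{x\in\mathcal K}(c-\mathrm B^{\intercal}u)^{\intercal}x$, $u\in\mathbb R^r$. A Clarke critical point of $g_0$ is a $u$ with $0\in\partial g_0(u)$, where $\partial f(x)=\{\xi:\limsup_{y\to x,\,t\downarrow0}\frac{f(y+tv)-f(y)}{t}\ge\xi^{\intercal}v\text{ for all }v\}$ is the Clarke subdifferential. Algorithm (input $u_\varepsilon\in\mathbb R^r$, $\eta_0>0$): 1. Pick any $\bar x\in\operatorname{argmin}_{x\in\mathcal K}(c-\mathrm B^{\intercal}u_\varepsilon)^{\intercal}x$ and set $\bar u=\mathrm B\bar x$. 2. If $(c-\mathrm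 B^{\intercal}\bar u)^{\intercal}\bar x>\min_{x\in\mathcal K}(c-\mathrm B^{\intercal}\bar u)^{\intercal}x$, stop and return ''$\bar u$ is not a local minimizer''. 3. Sample $w$ uniformly from the unit sphere of $\mathbb R^r$; set $\eta=\eta_0$, $u_+=\bar u+\eta w$, $u_-=\bar u-\eta w$, $s=\frac12\|\bar u\|^2+\min_{x\in\mathcal K}(c-\mathrm B^{\intercal}\bar u)^{\intercal}x$. 4. While loop; each iteration does the following. Pick any $x_+\in\operatorname{argmin}_{x\in\mathcal K}(c-\mathrm B^{\intercal}u_+)^{\intercal}x$ and $x_-\in\operatorname{argmin}_{x\in\mathcal K}(c-\mathrm B^{\intercal}u_-)^{\intercal}x$. If $\mathrm Bx_+=\mathrm Bx_-$, stop and return ''$\bar u$ is a local minimizer''. Otherwise set $s_\pm=\frac12\|\bar u\|^2+(c-\mathrm B^{\intercal}\bar u)^{\intercal}x_\pm$; if $s_+=s$ and $s_-=s$, stop and return ''$\bar u$ is not a local minimizer''; otherwise replace $\eta$ by $\eta/2$, set $u_+=\bar u+\eta w$, $u_-=\bar u-\eta w$, and repeat. ''Local minimizer'' refers to $g_0$. The probability is over $w$. $\operatorname{dist}$ is Euclidean distance with $\operatorname{dist}(z,\emptyset)=+\infty$; $\log_2(\eta_0/(+\infty))=-\infty$, and a maximum over an empty set is $-\infty$. *)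

(* Defs.v *)
From HB Require Import structures.
From mathcomp Require Import all_boot all_order all_algebra.
From mathcomp Require Import all_classical all_reals all_analysis.

Set Implicit Arguments.
Unset Strict Implicit.
Unset Printing Implicit Defensive.

Import Order.TTheory GRing.Theory Num.Theory.
Import numFieldNormedType.Exports.

Local Open Scope classical_set_scope.
Local Open Scope ring_scope.

(* The norm and topology that the library puts on ['cV[R]_n] come from the sup
   norm: same topology and same bounded sets as the Euclidean norm, but not the
   same distances, hence [dot], [enorm] and [edist_to]. *)
Definition dot (R : realType) (n : nat) (x y : 'cV[R]_n) : R :=
  \sum_i x i 0 * y i 0.

Definition enorm (R : realType) (n : nat) (x : 'cV[R]_n) : R :=
  Num.sqrt (dot x x).

(* Equal to +oo when [D] is empty. *)
Definition edist_to (R : realType) (n : nat) (z : 'cV[R]_n)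
    (D : set 'cV[R]_n) : \bar R :=
  ereal_inf [set (enorm (z - y))%:E | y in D].

Definition bd (T : topologicalType) (D : set T) : set T := closure D `\` D°.

Definition polyhedron (R : realType) (m n : nat) (A : 'M[R]_(m, n))
    (b : 'cV[R]_m) : set 'cV[R]_n :=
  [set x | A *m x = b /\ forall i, 0 <= x i 0].

(* Vertices are extreme points. *)
Definition vertices (R : realType) (n : nat) (K : set 'cV[R]_n) :
    set 'cV[R]_n :=
  [set x | K x /\ forall y z (t : R), K y -> K z -> 0 < t < 1 ->
     x = t *: y + (1 - t) *: z -> y = x /\ z = x].

Definition local_minimizer (T : topologicalType) (R : realType) (f : T -> R)
    (u : T) : Prop :=
  \forall y \near u, f u <= f y.

Definition clarke_derivative (R : realType) (r : nat) (f : 'cV[R]_r -> R)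
    (x v : 'cV[R]_r) : \bar R :=
  limf_esup (fun p : 'cV[R]_r * R => ((f (p.1 + p.2 *: v) - f p.1) / p.2)%:E)
    (filter_prod (nbhs x) (0^'+)).

Definition clarke_subdifferential (R : realType) (r : nat)
    (f : 'cV[R]_r -> R) (x : 'cV[R]_r) : set 'cV[R]_r :=
  [set xi | forall v, ((dot xi v)%:E <= clarke_derivative f x v)%E].

Definition clarke_critical (R : realType) (r : nat) (f : 'cV[R]_r -> R) :
    set 'cV[R]_r :=
  [set u | clarke_subdifferential f u 0].

Definition lin_cost (R : realType) (n r : nat) (c : 'cV[R]_n)
    (B : 'M[R]_(r, n)) (u : 'cV[R]_r) (x : 'cV[R]_n) : R :=
  dot (c - B^T *m u) x.

Definition lin_argmin (R : realType) (n r : nat) (K : set 'cV[R]_n)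
    (c : 'cV[R]_n) (B : 'M[R]_(r, n)) (u : 'cV[R]_r) : set 'cV[R]_n :=
  [set x | K x /\ forall y, K y -> lin_cost c B u x <= lin_cost c B u y].

(* For [K] nonempty and compact the infimum is attained. *)
Definition lin_min (R : realType) (n r : nat) (K : set 'cV[R]_n)
    (c : 'cV[R]_n) (B : 'M[R]_(r, n)) (u : 'cV[R]_r) : R :=
  inf [set lin_cost c B u x | x in K].

Definition g0 (R : realType) (n r : nat) (K : set 'cV[R]_n) (c : 'cV[R]_n)
    (B : 'M[R]_(r, n)) (u : 'cV[R]_r) : R :=
  2^-1 * enorm u ^+ 2 + lin_min K c B u.

Definition cell (R : realType) (n r V : nat) (c : 'cV[R]_n)
    (B : 'M[R]_(r, n)) (v : 'I_V -> 'cV[R]_n) (i : 'I_V) : set 'cV[R]_r :=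
  [set u | forall j, j != i -> lin_cost c B u (v i) <= lin_cost c B u (v j)].

Definition lambda (R : realType) (n r V : nat) (c : 'cV[R]_n)
    (B : 'M[R]_(r, n)) (v : 'I_V -> 'cV[R]_n) (u : 'cV[R]_r) : \bar R :=
  edist_to u (\bigcup_(j in [set j | ~ cell c B v j u]) cell c B v j).

Definition zeta (R : realType) (n r V : nat) (c : 'cV[R]_n)
    (B : 'M[R]_(r, n)) (v : 'I_V -> 'cV[R]_n) (i : 'I_V) (u : 'cV[R]_r) :
    \bar R :=
  ((2^-1)%:E * edist_to u (bd (cell c B v i)))%E.

Definition ceile (R : realType) (x : \bar R) : \bar R :=
  match x with
  | r%:E => ((Num.ceil r)%:~R : R)%:E
  | +oo => +oo
  | -oo => -oo
  end%E.

(* In extended reals: d = +oo gives eta0 / d = 0 and value -oo, while d = 0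
   gives eta0 / d = +oo and value +oo. *)
Definition ceil_log2_div (R : realType) (eta0 : R) (d : \bar R) : \bar R :=
  ceile (lne (eta0%:E / d) / (ln 2)%:E)%E.

Definition unit_sphere (R : realType) (r : nat) : set 'cV[R]_r :=
  [set w | enorm w = 1].

Definition borel_cV (R : realType) (r : nat) :=
  g_sigma_algebraType (@open 'cV[R]_r).

(* The uniform distribution on the sphere is the Borel probability carried by
   the sphere that is invariant under the orthogonal group. *)
Definition uniform_on_sphere (R : realType) (r : nat)
    (P : probability (borel_cV R r) R) : Prop :=
  P (@unit_sphere R r) = 1%E /\
  forall (Q : 'M[R]_r) (D : set (borel_cV R r)), Q^T *m Q = 1%:M ->
    measurable D -> P [set w : 'cV[R]_r | D (Q *m w)] = P D.

Inductive verdict := IsLocalMinimizer | IsNotLocalMinimizer.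

(* In iteration k (counted from 0) the step size is eta0 / 2 ^ k. The algorithm
   picks minimizers arbitrarily, so an execution is described by the sequences
   [xp] and [xm] of its picks in the successive iterations. An execution stops
   early: later entries of the sequences are then irrelevant. *)
Definition valid_picks (R : realType) (n r : nat) (K : set 'cV[R]_n)
    (c : 'cV[R]_n) (B : 'M[R]_(r, n)) (eta0 : R) (ubar w : 'cV[R]_r)
    (xp xm : nat -> 'cV[R]_n) : Prop :=
  forall k, lin_argmin K c B (ubar + (eta0 / 2 ^+ k) *: w) (xp k) /\
            lin_argmin K c B (ubar - (eta0 / 2 ^+ k) *: w) (xm k).

(* Body of the while loop; [None] means that the loop goes on. *)
Definition loop_body (R : realType) (n r : nat) (K : set 'cV[R]_n)
    (c : 'cV[R]_n) (B : 'M[R]_(r, n)) (ubar : 'cV[R]_r)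
    (xplus xminus : 'cV[R]_n) : option verdict :=
  let s := 2^-1 * enorm ubar ^+ 2 + lin_min K c B ubar in
  let splus := 2^-1 * enorm ubar ^+ 2 + lin_cost c B ubar xplus in
  let sminus := 2^-1 * enorm ubar ^+ 2 + lin_cost c B ubar xminus in
  if B *m xplus == B *m xminus then Some IsLocalMinimizer
  else if (splus == s) && (sminus == s) then Some IsNotLocalMinimizer
  else None.

(* Verdict of the loop after at most [N] iterations, if it has stopped. *)
Fixpoint while_loop (R : realType) (n r : nat) (K : set 'cV[R]_n)
    (c : 'cV[R]_n) (B : 'M[R]_(r, n)) (ubar : 'cV[R]_r)
    (xp xm : nat -> 'cV[R]_n) (N : nat) : option verdict :=
  if N is N'.+1 then
    if while_loop K c B ubar xp xm N' is Some o then Some o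
    else loop_body K c B ubar (xp N') (xm N')
  else None.

(* Verdict of the whole algorithm, run from the pick [xbar] of its first step
   and with at most [N] iterations of the loop. *)
Definition algorithm (R : realType) (n r : nat) (K : set 'cV[R]_n)
    (c : 'cV[R]_n) (B : 'M[R]_(r, n)) (xbar : 'cV[R]_n)
    (xp xm : nat -> 'cV[R]_n) (N : nat) : option verdict :=
  let ubar := B *m xbar in
  if lin_min K c B ubar < lin_cost c B ubar xbar
  then Some IsNotLocalMinimizer
  else while_loop K c B ubar xp xm N.

Definition terminates_within (R : realType) (n r : nat) (K : set 'cV[R]_n)
    (c : 'cV[R]_n) (B : 'M[R]_(r, n)) (xbar : 'cV[R]_n)
    (xp xm : nat -> 'cV[R]_n) (bound : \bar R) : Prop :=
  exists N : nat, (N%:R%:E <= bound)%E /\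
    exists o, algorithm K c B xbar xp xm N = Some o.

Definition returns_correctly (R : realType) (n r : nat) (K : set 'cV[R]_n)
    (c : 'cV[R]_n) (B : 'M[R]_(r, n)) (xbar : 'cV[R]_n)
    (xp xm : nat -> 'cV[R]_n) : Prop :=
  exists N o, algorithm K c B xbar xp xm N = Some o /\
    (o = IsLocalMinimizer <-> local_minimizer (g0 K c B) (B *m xbar)).

(* [ereal_sup] is the maximum over a finite set, -oo for the empty set. *)
Definition uniform_iteration_bound (R : realType) (n r V : nat)
    (K : set 'cV[R]_n) (c : 'cV[R]_n) (B : 'M[R]_(r, n))
    (v : 'I_V -> 'cV[R]_n) (eta0 : R) : \bar R :=
  let S := clarke_critical (g0 K c B) in
  (\big[maxe/-oo]_(i < V)
     maxe
       (maxe 0 (ereal_sup [set ceil_log2_div eta0 (zeta c B v i u) |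
                             u in S `&` (cell c B v i)°]) + 1)
       (maxe 0 (ereal_sup [set ceil_log2_div eta0 (lambda c B v u) |
                             u in S `&` bd (cell c B v i)]) + 2%:E))%E.

(* Main.v *)
Require Import Defs.
From HB Require Import structures.
From mathcomp Require Import all_boot all_order all_algebra.
From mathcomp Require Import all_classical all_reals all_analysis.
From mathcomp Require Import measurable_realfun ring lra.
Import Order.TTheory GRing.Theory Num.Theory.
Import numFieldNormedType.Exports.

(** Write [l_i u = c . v_i - u . p_i] with [p_i = B v_i] for the cost of the
    vertex [v_i], and [f u] for the minimum of the linear problem. A linear
    functional on a bounded polyhedron is minimized at a vertex
    ([polyhedron_vertex_le]), so [f] is the minimum of the finitely many affine
    functions [l_i], the cells are the closed sets [l_i = f], they cover the
    space, and only cells containing [u] are met near [u] ([near_cells]).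

    Where a single slope [p] is active at [u], every solution [x] of the linear
    problem at [u], vertex or not, has [B x = p]: otherwise moving [u] a little
    in the direction [B x - p] would make [x] cheaper than the minimum
    ([argmin_slope]). As [g0 = 1/2 |u|^2 + f], this yields the criterion behind
    the algorithm: [u] is a local minimizer iff all active slopes equal [u]
    ([local_min_slope], [slope_local_min]). It follows that the
    rejection before the loop is right ([reject_correct]) and that the loop
    never rejects a local minimizer ([loop_body_not_local_min]). The loop
    accepts when the solutions picked at [u + h] and [u - h] have the same image
    under [B], where [h = eta w]; then [f] is affine on the segment between the two points
    and all active slopes have the same component along [w]
    ([equal_slopes_flat]). If [w] is orthogonal to no nonzero difference
    [p_i - p_j], the active slopes coincide, hence equal [u].

    Such a [w] is almost sure because hyperplanes through the origin are null
    sets ([hyperplane_null]). By orthogonal invariance all of them have the same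
    probability [p]. Those orthogonal to the points [(1, t, ..., t^(r-1))] of
    the moment curve have the property that a nonzero [w] lies on at most [r] of
    them, a nonzero polynomial having at most as many roots as its degree.
    Integrating over the sphere the number of the first [N] of these hyperplanes
    that contain [w] gives [N p <= r] for every [N].

    For termination, the halved step enters, after the stated number of
    iterations, a ball around [u] inside the interior of a single cell (distance
    [zeta]: both picks have the same image, the loop accepts) or a ball meeting
    only cells that contain [u] (distance [lambda]: both picks are solutions at
    [u] by [argmin_mono], the loop stops one way or the other).

    If the loop is reached, then [u = B x] with [x] a solution at [u], so [u] is
    Clarke critical ([argmin_clarke_critical]). Two critical points lying in the
    same cells are equal ([clarke_critical_inj]); so there are finitely many of
    them and the maximum of the individual bounds over them is finite. *)

Local Open Scope classical_set_scope.
Local Open Scope ring_scope.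

Set Implicit Arguments.
Unset Strict Implicit.
Unset Printing Implicit Defensive.

(** * Euclidean inner product *)

Section Dot.
Variables (R : realType) (n : nat).
Implicit Types (x y z : 'cV[R]_n) (a : R).

Lemma dotE x y : dot x y = (x^T *m y) 0 0.
Proof. by rewrite mxE; apply: eq_bigr => i _; rewrite mxE. Qed.

Lemma dotC x y : dot x y = dot y x.
Proof. by apply: eq_bigr => i _; rewrite mulrC. Qed.

Lemma dotDr x y z : dot x (y + z) = dot x y + dot x z.
Proof. by rewrite !dotE mulmxDr mxE. Qed.

Lemma dotZr a x y : dot x (a *: y) = a * dot x y.
Proof. by rewrite !dotE -scalemxAr mxE. Qed.

Lemma dotNr x y : dot x (- y) = - dot x y.
Proof. by rewrite -scaleN1r dotZr mulN1r. Qed.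

Lemma dotDl x y z : dot (y + z) x = dot y x + dot z x.
Proof. by rewrite !(dotC _ x) dotDr. Qed.

Lemma dotZl a x y : dot (a *: y) x = a * dot y x.
Proof. by rewrite !(dotC _ x) dotZr. Qed.

Lemma dotNl x y : dot (- y) x = - dot y x.
Proof. by rewrite !(dotC _ x) dotNr. Qed.

Lemma dot0r x : dot x 0 = 0.
Proof. by rewrite dotE mulmx0 mxE. Qed.

Definition dot_lin := (dotDl, dotDr, dotNl, dotNr, dotZl, dotZr).

Lemma dot_ge0 x : 0 <= dot x x.
Proof. by apply: sumr_ge0 => i _; rewrite -expr2 sqr_ge0. Qed.

Lemma dot_eq0 x : (dot x x == 0) = (x == 0).
Proof.
apply/eqP/eqP => [/eqP|->]; last by rewrite dot0r.
rewrite psumr_eq0 => [/allP x0|i _]; last by rewrite -expr2 sqr_ge0.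
apply/matrixP => i j; rewrite ord1 mxE.
by have := x0 i (mem_index_enum i); rewrite mulf_eq0 orbb => /eqP.
Qed.

Lemma dot_le0 x : dot x x <= 0 -> x = 0.
Proof. by move=> xx; apply/eqP; rewrite -dot_eq0 eq_le xx dot_ge0. Qed.

Lemma enorm_sqr x : enorm x ^+ 2 = dot x x.
Proof. by rewrite sqr_sqrtr // dot_ge0. Qed.

Lemma enorm_ge0 x : 0 <= enorm x.
Proof. exact: sqrtr_ge0. Qed.

Lemma enormZ a x : enorm (a *: x) = `|a| * enorm x.
Proof.
by rewrite /enorm dotZl dotZr mulrA -expr2 sqrtrM ?sqr_ge0 // sqrtr_sqr.
Qed.

Lemma enormN x : enorm (- x) = enorm x.
Proof. by rewrite -scaleN1r enormZ normrN1 mul1r. Qed.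

Lemma coord_le_enorm x i : `|x i 0| <= enorm x.
Proof.
rewrite -sqrtr_sqr ler_sqrt; last exact: dot_ge0.
rewrite /dot (bigD1 i) //= -expr2 lerDl.
by apply: sumr_ge0 => j _; rewrite -expr2 sqr_ge0.
Qed.

End Dot.

Lemma dot_mulmx (R : realType) (m n : nat) (B : 'M[R]_(m, n)) x y :
  dot (B^T *m x) y = dot x (B *m y).
Proof. by rewrite !dotE trmx_mul trmxK mulmxA. Qed.

(** * Linear functionals on a bounded polyhedron *)

Section VertexOptimum.
Variables (R : realType) (m n : nat) (A : 'M[R]_(m, n)) (b : 'cV[R]_m).
Let K := polyhedron A b.
Hypothesis K_bounded : bounded_set K.

Lemma bounded_polyhedron_coord :
  exists C : R, forall x, K x -> forall i, x i 0 <= C.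
Proof.
have [C [Creal Cb]] := K_bounded; exists (C + 1) => x Kx i.
have := Cb (C + 1); rewrite ltrDl ltr01 => /(_ isT x Kx); apply: le_trans.
apply: le_trans (ler_norm _) _; rewrite [leRHS]/Num.Def.normr /= mx_normrE.
by apply/bigmax_geP; right => /=; exists (i, 0).
Qed.

Let supp (x : 'cV[R]_n) := [set i | x i 0 != 0]%SET.

(** Otherwise [x + s d] would stay in [K] for all [s >= 0], and [K] is
    bounded. *)
Lemma recession_direction_neg (x d : 'cV[R]_n) : K x -> A *m d = 0 -> d != 0 ->
  exists i, d i 0 < 0.
Proof.
move=> Kx Ad d0; apply: contrapT => /forallNP dge0.
have {}dge0 i : 0 <= d i 0 by rewrite leNgt; apply/negP/dge0.
have [C Cb] := bounded_polyhedron_coord.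
have [i di] : exists i, d i 0 != 0.
  apply: contrapT => /forallNP di0; move/eqP: d0; apply.
  by apply/matrixP => i j; rewrite ord1 mxE; apply/eqP/negPn/negP/di0.
have dgt0 : 0 < d i 0 by rewrite lt_def di dge0.
have C0 : 0 <= C by apply: le_trans (Cb _ Kx i); case: Kx.
have [Ax x0] := Kx.
have Kxd : K (x + ((C + 1) / d i 0) *: d).
  split; first by rewrite mulmxDr Ax -scalemxAr Ad scaler0 addr0.
  move=> j; rewrite !mxE; apply: addr_ge0 => //; apply: mulr_ge0 => //.
  by apply: divr_ge0; [lra | exact: ltW].
have := Cb _ Kxd i; rewrite !mxE divfK //; have := x0 i; lra.
Qed.

(** Starting from [x], the ray of direction [d] leaves the positive orthant. The
    last point of [K] on it has lost a coordinate of the support of [x], and has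
    gained none since [d] vanishes outside that support. *)
Lemma polyhedron_step (a x d : 'cV[R]_n) : K x -> A *m d = 0 -> d != 0 ->
    (forall i, x i 0 = 0 -> d i 0 = 0) -> dot a d <= 0 ->
  exists y, [/\ K y, dot a y <= dot a x & supp y \proper supp x].
Proof.
move=> Kx Ad d0 dx ad; have [i0 di0] := recession_direction_neg Kx Ad d0.
pose F i := x i 0 / - d i 0.
(* [F i] is the time at which the ray hits [x i 0 = 0]. *)
have [i /= di iF] := @arg_minP _ _ _ i0 (fun i => d i 0 < 0) F di0.
have [Ax x0] := Kx.
have Fge0 : 0 <= F i by apply: divr_ge0 => //; lra.
exists (x + F i *: d); split.
- split; first by rewrite mulmxDr Ax -scalemxAr Ad scaler0 addr0.
  move=> j; rewrite !mxE.
  have [dj|dj] := leP 0 (d j 0).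
    by apply: addr_ge0 => //; apply: mulr_ge0.
  have := iF j dj; rewrite ler_pdivlMr; last by lra.
  by rewrite mulrN lerNl -subr_ge0 opprK addrC.
- by rewrite dotDr dotZr gerDl mulr_ge0_le0.
- apply/properP; split.
    apply/fintype.subsetP => j; rewrite !inE !mxE; apply: contra_neq => xj.
    by rewrite xj dx // mulr0 addr0.
  exists i; rewrite inE.
    by apply: contra_ltN di => /eqP xi; rewrite dx.
  by rewrite !mxE /F invrN mulrN mulNr divfK ?subrr ?eqxx // lt_eqF.
Qed.

(** A point that is not a vertex lies inside a segment of [K]. One of the two
    directions of this segment does not increase the functional; following it
    shrinks the support, so that iterating ends, at a vertex. *)
Lemma polyhedron_vertex_le (a x : 'cV[R]_n) : K x ->
  exists2 y, vertices K y & dot a y <= dot a x.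
Proof.
have [k] := ubnP #|supp x|; elim: k x => // k IH x /ltnSE xk Kx.
have [xv|] := pselect (vertices K x); first by exists x.
move=> xNv.
have [d [Ad d0 dx]] : exists d : 'cV[R]_n, [/\ A *m d = 0, d != 0 &
    forall i, x i 0 = 0 -> d i 0 = 0].
  apply: contrapT => Nd; apply: xNv; split=> // y z t Ky Kz /andP[t0 t1] xE.
  have yz : y = z.
    apply/eqP; rewrite -subr_eq0; apply: contrapT => /negP yz.
    apply: Nd; exists (y - z); split => //.
      by rewrite mulmxBr Ky.1 Kz.1 subrr.
    move=> i; rewrite xE !mxE => E.
    have y0 := Ky.2 i; have z0 := Kz.2 i.
    have ty : 0 <= t * y i 0 by apply: mulr_ge0 => //; lra.
    have tz : 0 <= (1 - t) * z i 0 by apply: mulr_ge0 => //; lra.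
    have /eqP : t * y i 0 = 0 by lra.
    have /eqP : (1 - t) * z i 0 = 0 by lra.
    rewrite !mulf_eq0 => /orP[/eqP|/eqP->]; first by lra.
    by move=> /orP[/eqP|/eqP->]; [lra | rewrite subrr].
  by rewrite xE yz -scalerDl addrC subrK scale1r.
have [y [Ky ayx yx]] : exists y,
    [/\ K y, dot a y <= dot a x & supp y \proper supp x].
  have [ad|ad] := leP (dot a d) 0; first exact: polyhedron_step Kx Ad d0 dx ad.
  apply: (@polyhedron_step a x (- d)) => //.
  - by rewrite mulmxN Ad oppr0.
  - by rewrite oppr_eq0.
  - by move=> i /dx; rewrite !mxE => ->; rewrite oppr0.
  - by rewrite dotNr; lra.
have [|z zv azy] := IH y _ Ky; first exact: leq_trans (proper_card yx) xk.
by exists z => //; apply: le_trans azy ayx.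
Qed.

End VertexOptimum.

(** * Euclidean balls and distances in the product topology *)

Lemma dot_cvg (R : realType) (n : nat) (T : Type) (F : set_system T)
    {FF : Filter F} (f g : T -> 'cV[R]_n) (x y : 'cV[R]_n) :
  f t @[t --> F] --> x -> g t @[t --> F] --> y ->
  dot (f t) (g t) @[t --> F] --> dot x y.
Proof.
move=> fx gy; apply: cvg_big => [|i _]; first exact: add_continuous.
apply: cvgM.
  exact: (continuous_cvg FF (@coord_continuous R n 1 i 0 x) fx).
exact: (continuous_cvg FF (@coord_continuous R n 1 i 0 y) gy).
Qed.

Lemma enorm_cvg (R : realType) (n : nat) (T : Type) (F : set_system T)
    {FF : Filter F} (f : T -> 'cV[R]_n) (x : 'cV[R]_n) :
  f t @[t --> F] --> x -> enorm (f t) @[t --> F] --> enorm x.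
Proof.
move=> fx.
exact: (continuous_cvg FF (@sqrt_continuous R (dot x x)) (dot_cvg fx fx)).
Qed.

Lemma enormB_cvg (R : realType) (n : nat) (T : Type) (F : set_system T)
    {FF : Filter F} (f : T -> 'cV[R]_n) (u x : 'cV[R]_n) :
  f t @[t --> F] --> x -> enorm (u - f t) @[t --> F] --> enorm (u - x).
Proof. by move=> fx; apply: enorm_cvg; apply: cvgB => //; exact: cvg_cst. Qed.

(** The library topology is that of the sup norm; this is the bridge to the
    Euclidean distances in the definitions of [lambda] and [zeta]. *)
Lemma nbhs_enorm (R : realType) (n : nat) (u : 'cV[R]_n) (D : set 'cV[R]_n) :
  nbhs u D <-> exists2 e : R, 0 < e & forall y, enorm (u - y) < e -> D y.
Proof.
split=> [/nbhs_ballP[e /= e0 eD]|[e e0 eD]].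
  exists e => // y uy; apply: eD; split=> // i j; rewrite ord1 /ball /=.
  by apply: le_lt_trans uy; have := @coord_le_enorm _ _ (u - y) i; rewrite !mxE.
have : enorm (u - y) @[y --> u] --> enorm (u - u).
  exact: (@enormB_cvg _ _ _ (nbhs u) _ id u u (fun D uD => uD)).
move=> /cvgr_lt /(_ e); rewrite subrr -(scale0r 0) enormZ normr0 mul0r.
by move=> /(_ e0); apply: filterS => y; apply: eD.
Qed.

Section Distance.
Variables (R : realType) (r : nat).
Implicit Types (u y : 'cV[R]_r) (D : set 'cV[R]_r).

Lemma edist_to_gt0 u D : nbhs u (~` D) -> (0 < edist_to u D)%E.
Proof.
move=> /nbhs_enorm[e e0 eD]; apply: (@lt_le_trans _ _ e%:E).
  by rewrite lte_fin.
apply: le_ereal_inf_tmp => _ [y Dy <-]; rewrite lee_fin leNgt.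
by apply/negP => /eD.
Qed.

Lemma edist_to_gt u y D : ((enorm (u - y))%:E < edist_to u D)%E -> ~ D y.
Proof.
move=> uy Dy; move: uy; rewrite ltNge => /negP; apply.
by apply: ereal_inf_lbound; exists y.
Qed.

(** The trace of [D] on [A] is both open and closed in [A] when [A] avoids the
    boundary of [D]. *)
Lemma connected_bd (T : topologicalType) (A D : set T) :
  connected A -> closed D -> A `&` D° !=set0 -> A `&` bd D = set0 ->
  A `<=` D°.
Proof.
move=> Ac Dc AD Abd.
have E : A `&` D° = A `&` D.
  apply/seteqP; split=> x [Ax Dx]; split=> //; first exact: interior_subset.
  apply: contrapT => xD.
  have : (A `&` bd D) x by split=> //; split=> //; exact: subset_closure.
  by rewrite Abd.
have <- : A `&` D° = A.
  by apply: Ac => //; [exists D° => //; exact: open_interior | exists D].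
exact: subIsetr.
Qed.

(** The segment from [u] to [u + t w] is connected and too short to reach the
    boundary of [D]. *)
Lemma dist_bd_interior u w D (t : R) : closed D -> D° u -> enorm w = 1 ->
  0 <= t -> (t%:E < edist_to u (bd D))%E -> D° (u + t *: w).
Proof.
move=> Dc Du w1 t0 td.
pose f (s : R) := u + s *: w.
have fc : continuous f.
  by move=> s; apply: cvgD; [exact: cvg_cst|apply: cvgZl; exact: cvg_id].
have : f @` `[0, t] `<=` D°.
  apply: connected_bd => //.
  - apply: connected_continuous_connected; first exact: segment_connected.
    exact: continuous_subspaceT.
  - exists u; split=> //; exists 0; last by rewrite /f scale0r addr0.
    by rewrite /= in_itv /= lexx.
  - apply/seteqP; split=> // y [[s /=]]; rewrite in_itv /= => /andP[s0 st] <-.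
    apply: edist_to_gt; apply: le_lt_trans td.
    by rewrite /f opprD addNKr enormN enormZ w1 mulr1 ger0_norm // lee_fin.
by apply; exists t => //; rewrite /= in_itv /= lexx t0.
Qed.

End Distance.

(** * Number of halvings of the step size *)

Section HalvingCount.
Variable R : realType.

(** The smallest [N] with [eta0 / 2 ^ N <= d] is the maximum of 0 and the
    ceiling of [log2 (eta0 / d)]. For [d = +oo] the step need not be halved at
    all. *)
Lemma halving_count (eta0 : R) (d : \bar R) : 0 < eta0 -> (0 < d)%E ->
  exists N : nat, maxe 0%E (ceil_log2_div eta0 d) = N%:R%:E /\
    ((eta0 / 2 ^+ N)%:E <= d)%E.
Proof.
move=> eta0_gt0; case: d => [d|_|//].
  rewrite lte_fin => d0; rewrite /ceil_log2_div.
  have l2 : 0 < ln (2 : R) by rewrite ln_gt0 // ltr1n.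
  have -> : (eta0%:E / d%:E)%E = (eta0 / d)%:E by rewrite inver gt_eqF.
  rewrite /lne leNgt divr_gt0 //= inver gt_eqF //= -EFin_max.
  set z := Num.ceil _.
  pose z0 : int := Num.max 0 z.
  have z0_ge0 : 0 <= z0 by rewrite le_max lexx.
  exists (absz z0); split.
    by congr EFin; rewrite natr_absz ger0_norm // /z0 !maxEle ler0z;
      case: ifP.
  rewrite lee_fin ler_pdivrMr ?exprn_gt0 // mulrC -ler_pdivrMr //.
  rewrite -ler_ln ?posrE ?divr_gt0 ?exprn_gt0 // lnXn //.
  rewrite -[leRHS]mulr_natl -ler_pdivrMr //.
  apply: le_trans (ceil_ge _) _; rewrite natr_absz ger0_norm //.
  by rewrite ler_int le_max lexx orbT.
exists 0%N; split; last by rewrite leey.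
by rewrite /ceil_log2_div invey mule0 /= lexx inver gt_eqF ?ln_gt0 ?ltr1n //
  mulNyr gtr0_sg ?invr_gt0 ?ln_gt0 ?ltr1n // mul1e maxeNy.
Qed.

Lemma ceil_log2_div_lty (eta0 : R) (d : \bar R) : 0 < eta0 -> (0 < d)%E ->
  (ceil_log2_div eta0 d < +oo)%E.
Proof.
move=> e0 d0; have [N [E _]] := halving_count e0 d0.
apply: le_lt_trans (ltry N%:R); rewrite -E le_max lexx orbT //.
Qed.

End HalvingCount.

(** * Filters and finite suprema *)

Lemma small_multiple (R : realType) (n : nat) (h : 'cV[R]_n) (e : R) : 0 < e ->
  exists2 t : R, 0 < t <= 1 & enorm (t *: h) < e.
Proof.
move=> e0; have h0 := enorm_ge0 h.
have d0 : 0 < e + enorm h by lra.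
(* The denominator is nonzero for [h = 0] too. *)
exists (e / (e + enorm h)).
  by rewrite divr_gt0 // ler_pdivrMr // mul1r; lra.
rewrite enormZ ger0_norm; last by rewrite divr_ge0 //; lra.
by rewrite mulrAC ltr_pdivrMr // ltr_pM2l //; lra.
Qed.

Lemma at_right0P (R : realType) (Q : set R) :
  (0 : R)^'+ Q <-> exists2 e, 0 < e & forall t, 0 < t -> t < e -> Q t.
Proof.
split=> [/nbhs_ballP[e /= e0 eQ]|[e e0 eQ]].
  exists e => // t t0 te; apply: eQ => //.
  by rewrite /ball /= sub0r normrN gtr0_norm.
apply/nbhs_ballP; exists e => //= t; rewrite /ball /= sub0r normrN => te t0.
by apply: eQ => //; rewrite -(gtr0_norm t0).
Qed.

Lemma finite_ereal_sup_lty (R : realType) (A : set (\bar R)) :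
  finite_set A -> (forall x, A x -> x < +oo)%E -> (ereal_sup A < +oo)%E.
Proof.
move=> /finite_seqP[s ->] slt.
apply: (@le_lt_trans _ _ (\big[maxe/-oo%E]_(x <- s) x)).
  apply: ge_ereal_sup => x /= xs.
  exact: (@le_bigmax_seq _ _ _ s _ x xpredT id).
by rewrite big_seq; apply: bigmax_lt => // x xs; exact: slt.
Qed.

(** * The linear cost as a function of the dual point *)

Section LinearCost.
Variables (R : realType) (n r : nat) (c : 'cV[R]_n) (B : 'M[R]_(r, n)).
Implicit Types (u h w : 'cV[R]_r) (x y : 'cV[R]_n).

Lemma lin_costE u x : lin_cost c B u x = dot c x - dot u (B *m x).
Proof. by rewrite /lin_cost dotDl dotNl dot_mulmx. Qed.

Lemma lin_costD u h x :
  lin_cost c B (u + h) x = lin_cost c B u x - dot h (B *m x).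
Proof. by rewrite !lin_costE dotDl; lra. Qed.

Lemma lin_cost_cvg (T : Type) (F : set_system T) {FF : Filter F}
    (f : T -> 'cV[R]_r) u x : f t @[t --> F] --> u ->
  lin_cost c B (f t) x @[t --> F] --> lin_cost c B u x.
Proof.
move=> fu; under eq_fun do rewrite lin_costE.
rewrite lin_costE; apply: cvgB; first exact: cvg_cst.
by apply: dot_cvg => //; exact: cvg_cst.
Qed.

Lemma near_lin_cost_lt u x y : lin_cost c B u x < lin_cost c B u y ->
  \forall u' \near u, lin_cost c B u' x < lin_cost c B u' y.
Proof.
move=> xy.
have costB u' : lin_cost c B u' (x - y) = lin_cost c B u' x - lin_cost c B u' y.
  by rewrite /lin_cost dotDr dotNr.
have : lin_cost c B u' (x - y) @[u' --> u] --> lin_cost c B u (x - y).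
  exact: (@lin_cost_cvg _ (nbhs u) _ id u (x - y) (fun D uD => uD)).
move=> /cvgr_lt /(_ 0); rewrite costB subr_lt0 => /(_ xy).
by apply: filterS => u'; rewrite costB subr_lt0.
Qed.

End LinearCost.

(** * Cells, active slopes and local minimizers *)

Section Cells.
Variables (R : realType) (n r V : nat) (K : set 'cV[R]_n) (c : 'cV[R]_n).
Variables (B : 'M[R]_(r, n)) (v : 'I_V -> 'cV[R]_n).
Hypothesis K_neq0 : K !=set0.
Hypothesis vK : forall i, K (v i).
Hypothesis v_le : forall u x, K x ->
  exists i, lin_cost c B u (v i) <= lin_cost c B u x.

Implicit Types (u h w : 'cV[R]_r) (x y : 'cV[R]_n) (i j : 'I_V).
Local Notation cost := (lin_cost c B).
Local Notation argmin := (lin_argmin K c B).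
Local Notation f := (lin_min K c B).
Local Notation C := (cell c B v).
Local Notation g := (g0 K c B).

Lemma cellE i u : C i u <-> forall j, cost u (v i) <= cost u (v j).
Proof.
split=> [Ci j|Ci j _]; last exact: Ci.
by have [->//|ji] := eqVneq j i; apply: Ci.
Qed.

Lemma cell_argmin i u : C i u <-> argmin u (v i).
Proof.
split=> [/cellE Ci|[_ vi]]; last by apply/cellE => j; apply: vi.
by split=> // x /(v_le u)[j]; apply: le_trans.
Qed.

Lemma cell_cover u : exists i, C i u.
Proof.
have [x Kx] := K_neq0; have [i0 _] := v_le u Kx.
have [i _ ile] := @arg_minP _ _ _ i0 xpredT (fun i => cost u (v i)) isT.
by exists i; apply/cellE => j; apply: ile.
Qed.

Lemma lin_minE u x : argmin u x -> f u = cost u x.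
Proof.
move=> [Kx xle]; apply/eqP; rewrite eq_le; apply/andP; split.
  apply: ge_inf; last by exists x.
  by exists (cost u x) => _ [y Ky <-]; apply: xle.
apply: lb_le_inf; first by exists (cost u x); exists x.
by move=> _ [y Ky <-]; apply: xle.
Qed.

Lemma lin_min_cell i u : C i u -> f u = cost u (v i).
Proof. by move=> /cell_argmin/lin_minE. Qed.

Lemma lin_min_le u x : K x -> f u <= cost u x.
Proof.
move=> Kx; have [i Ci] := cell_cover u; rewrite (lin_min_cell Ci).
by have /cell_argmin[_] := Ci; apply.
Qed.

Lemma argminE u x : argmin u x <-> K x /\ cost u x = f u.
Proof.
split=> [ux|[Kx xE]]; first by rewrite (lin_minE ux); case: ux.
by split=> // y Ky; rewrite xE; apply: lin_min_le.
Qed.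

Lemma near_cellN i u : ~ C i u -> \forall u' \near u, ~ C i u'.
Proof.
move=> NCi.
have /existsNP[j /negP] : ~ forall j, cost u (v i) <= cost u (v j).
  by move=> /cellE.
rewrite -ltNge => ji.
have := near_lin_cost_lt ji.
by apply: filterS => u' u'ij /cellE/(_ j); rewrite leNgt u'ij.
Qed.

Lemma cell_closed i : closed (C i).
Proof. by rewrite -openC openE => u; exact: near_cellN. Qed.

(** The cells that do not contain [u] are finitely many closed sets. *)
Lemma near_cells u : exists2 e : R, 0 < e &
  forall u', enorm (u - u') < e -> forall i, C i u' -> C i u.
Proof.
apply/nbhs_enorm; apply: (@filter_forall _ _ _ (nbhs u)) => i.
have [Ci|/near_cellN] := pselect (C i u); first exact: (nearW (F := nbhs u)).
by apply: (filterS (F := nbhs u)) => u' Nu' /Nu'.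
Qed.

(** Moving from [u] by a small multiple [t h] of [h = B x - p] changes the
    minimum by [- t h . p] and the cost of [x] by [- t h . B x]. As [x] cannot
    get below the minimum, [h . h <= 0]. *)
Lemma argmin_slope_near u x (p : 'cV[R]_r) (e : R) : 0 < e ->
    (forall u', enorm (u - u') < e ->
       exists i, [/\ C i u, C i u' & B *m v i = p]) ->
  argmin u x -> B *m x = p.
Proof.
move=> e0 up ux; have [Kx _] := ux.
have [t /andP[t0 t1] te] := small_multiple (B *m x - p) e0.
set h := _ - p in te.
have [|i [Ci Ci' ip]] := up (u + t *: h); first by rewrite opprD addNKr enormN.
have := lin_min_le (u + t *: h) Kx; rewrite (lin_min_cell Ci') !lin_costD.
rewrite -(lin_minE ux) -(lin_min_cell Ci) lerD2l lerN2 ip !dotZl ler_pM2l //.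
move=> hx; apply/eqP; rewrite -subr_eq0; apply/eqP/dot_le0.
by rewrite -/h {2}/h dotDr dotNr subr_le0.
Qed.

(** This is where arbitrary picks, which need not be vertices, are reduced to
    the active vertices. *)
Lemma argmin_slope u x (p : 'cV[R]_r) : argmin u x ->
  (forall i, C i u -> B *m v i = p) -> B *m x = p.
Proof.
move=> ux up; have [e e0 ue] := near_cells u.
apply: (argmin_slope_near e0) ux => u' uu'; have [i Ci'] := cell_cover u'.
by have Ci := ue _ uu' _ Ci'; exists i; split=> //; apply: up.
Qed.

Lemma interior_cell_slope i u x : (C i)° u -> argmin u x -> B *m x = B *m v i.
Proof.
move=> /nbhs_enorm[e e0 ui]; apply: (argmin_slope_near e0) => u' uu'.
exists i; split=> //; apply: ui => //.
by rewrite subrr -(scale0r 0) enormZ normr0 mul0r.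
Qed.

(** Beyond [u'] on the half-line from [u] some cell [i] containing [u'], hence
    [u], is still active. The affine function [cost x - l_i] vanishes at [u']
    and is nonnegative beyond it, so it is at most 0 at [u]: the cost of [x] at
    [u] does not exceed the minimum. *)
Lemma argmin_mono u u' : (forall i, C i u' -> C i u) -> argmin u' `<=` argmin u.
Proof.
move=> u'u x u'x; have [Kx _] := u'x; apply/argminE; split=> //.
have [e e0 ue] := near_cells u'.
have [t /andP[t0 t1] te] := small_multiple (u' - u) e0.
have [i Ci''] := cell_cover (u' + t *: (u' - u)).
have Ci' : C i u' by apply: ue Ci''; rewrite opprD addNKr enormN.
apply/eqP; rewrite eq_le lin_min_le // andbT (lin_min_cell (u'u _ Ci')).
have := lin_min_le (u' + t *: (u' - u)) Kx.
have := lin_minE u'x; rewrite (lin_min_cell Ci') (lin_min_cell Ci'').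
rewrite !lin_costD -lerBrDl => E.
rewrite E addrAC subrr add0r lerN2 !dotZl ler_pM2l // => le.
move: E le; rewrite !lin_costE !dotDl !dotNl; lra.
Qed.

(** The quadratic [1/2 |y|^2 + cost y x] is at least [g0] and equal to it at
    [u], so it has a local minimum at [u], where its gradient is [u - B x]. *)
Lemma local_min_slope u x : local_minimizer g u -> argmin u x -> B *m x = u.
Proof.
move=> /nbhs_enorm[e e0 ue] ux; have [Kx _] := ux.
have [t /andP[t0 t1] te] := small_multiple (B *m x - u) e0.
set h := _ - u in te; have Bx : B *m x = u + h by rewrite addrC subrK.
clearbody h.
have := ue (u + t *: h); rewrite opprD addNKr enormN => /(_ te).
have := lin_min_le (u + t *: h) Kx.
rewrite /g0 (lin_minE ux) lin_costD !enorm_sqr.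
rewrite Bx !dot_lin (dotC h u) => le1 le2.
suff -> : h = 0 by rewrite addr0.
apply: dot_le0.
have : t * (1 - t / 2) * dot h h <= 0 by lra.
by rewrite pmulr_rle0 // mulr_gt0 //; lra.
Qed.

(** Near [u], the function [g0] is a minimum of pieces
    [1/2 |y - u|^2 + constant]. *)
Lemma slope_local_min u : (forall i, C i u -> B *m v i = u) ->
  local_minimizer g u.
Proof.
move=> uslope; apply/nbhs_enorm; have [e e0 ue] := near_cells u.
exists e => // y uy; have [i Cy] := cell_cover y; have Ci := ue _ uy _ Cy.
rewrite /g0 (lin_min_cell Ci) (lin_min_cell Cy) !enorm_sqr.
rewrite !lin_costE (uslope _ Ci).
have := dot_ge0 (y - u); rewrite !dot_lin (dotC u y); lra.
Qed.

(** At a local minimizer [u = B x], an active vertex [v_i] has the same image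
    [u] as [x] under [B]. Then [v_i] and [x] compare in the same way at every
    dual point, namely by [c . v_i] and [c . x], and [x], optimal at [ueps], is
    also optimal at [u]. *)
Lemma reject_correct ueps x : argmin ueps x -> ~ argmin (B *m x) x ->
  ~ local_minimizer g (B *m x).
Proof.
move=> epsx uNx loc; apply: uNx; have [Kx xle] := epsx.
have [i Ci] := cell_cover (B *m x).
have ip := local_min_slope loc ((cell_argmin _ _).1 Ci).
apply/argminE; split=> //; apply/eqP; rewrite eq_le lin_min_le // andbT.
rewrite (lin_min_cell Ci); have := xle _ (vK i).
by rewrite !lin_costE ip !lerD2r.
Qed.


(** * Verdicts of the algorithm *)

(** The costs of [xp] and [xm] differ by a constant, and each is optimal at one
    end of the segment from [u - h] to [u + h], so [xp] is optimal at both ends.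
    The affine function [cost x - cost xp] is therefore nonnegative at the ends
    and at most 0 at the midpoint [u], so it is constant along [h]. *)
Lemma equal_slopes_flat u h x xp xm : argmin u x ->
  argmin (u + h) xp -> argmin (u - h) xm -> B *m xp = B *m xm ->
  dot h (B *m x) = dot h (B *m xp).
Proof.
move=> [Kx ux] [Kp up] [Km um] pm.
have := up _ Km; have := um _ Kp; rewrite !lin_costE -pm !lerD2r => mp pm'.
have := up _ Kx; have := um _ Kx; have := ux _ Kp; have := ux _ Km.
rewrite !lin_costE -pm !dotDl !dotNl; lra.
Qed.

(** The hypothesis on [h] is what holds for almost every direction. The common
    active slope is [u] itself because [u = B xbar] for a solution [xbar]
    at [u]. *)
Lemma equal_slopes_local_min u h xbar xp xm :
    (forall i j, dot h (B *m v i - B *m v j) = 0 -> B *m v i = B *m v j) ->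
    argmin u xbar -> B *m xbar = u ->
    argmin (u + h) xp -> argmin (u - h) xm -> B *m xp = B *m xm ->
  local_minimizer g u.
Proof.
move=> hgen uxbar xbaru up um pm; have [i Ci] := cell_cover u.
have flat j : C j u -> dot h (B *m v j) = dot h (B *m xp).
  by move=> /cell_argmin uj; apply: equal_slopes_flat uj up um pm.
have slope j : C j u -> B *m v j = B *m v i.
  by move=> Cj; apply: hgen; rewrite dotDr dotNr (flat _ Cj) (flat _ Ci) subrr.
have iu : B *m v i = u by rewrite -xbaru (argmin_slope uxbar slope).
by apply: slope_local_min => j Cj; rewrite slope.
Qed.

(** Two solutions at [u] have distinct images under [B], whereas
    [local_min_slope] makes both images equal to [u]. *)
Lemma loop_body_not_local_min u xp xm : K xp -> K xm ->
  loop_body K c B u xp xm = Some IsNotLocalMinimizer -> ~ local_minimizer g u.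
Proof.
move=> Kp Km; rewrite /loop_body; case: eqP => // pm.
case: ifP => // /andP[/eqP/addrI sp /eqP/addrI sm] _ loc; apply: pm.
rewrite (local_min_slope loc) ?(local_min_slope loc) //; exact/argminE.
Qed.

Lemma loop_body_local_min u xp xm :
  loop_body K c B u xp xm = Some IsLocalMinimizer -> B *m xp = B *m xm.
Proof. by rewrite /loop_body; case: eqP => // _; case: ifP. Qed.

Lemma loop_body_stops u xp xm :
  B *m xp = B *m xm \/ argmin u xp /\ argmin u xm ->
  exists o, loop_body K c B u xp xm = Some o.
Proof.
rewrite /loop_body => -[->|[up um]]; first by rewrite eqxx; eexists.
by case: ifP; last rewrite -(lin_minE up) -(lin_minE um) !eqxx; eexists.
Qed.

Lemma while_loop_Some u (xp xm : nat -> 'cV[R]_n) N o :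
  while_loop K c B u xp xm N = Some o ->
  exists k, loop_body K c B u (xp k) (xm k) = Some o.
Proof.
elim: N => //= N IH; case E: while_loop => [vd|]; last by exists N.
by move=> [vdo]; apply: IH; rewrite E vdo.
Qed.

Lemma while_loop_stops u (xp xm : nat -> 'cV[R]_n) N o :
  loop_body K c B u (xp N) (xm N) = Some o ->
  exists o', while_loop K c B u xp xm N.+1 = Some o'.
Proof. by move=> /= ->; case: while_loop => [vd|]; eexists. Qed.

Lemma algorithm_stops (xbar : 'cV[R]_n) (xp xm : nat -> 'cV[R]_n) N o :
  loop_body K c B (B *m xbar) (xp N) (xm N) = Some o ->
  exists o', algorithm K c B xbar xp xm N.+1 = Some o'.
Proof.
move=> /while_loop_stops[vd E]; rewrite /algorithm.
by case: ifP; [eexists | rewrite E; eexists].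
Qed.

Lemma algorithm_correct ueps w (eta0 : R) (xbar : 'cV[R]_n)
    (xp xm : nat -> 'cV[R]_n) N o : 0 < eta0 ->
    argmin ueps xbar -> valid_picks K c B eta0 (B *m xbar) w xp xm ->
    (forall i j, dot w (B *m v i - B *m v j) = 0 -> B *m v i = B *m v j) ->
    algorithm K c B xbar xp xm N = Some o ->
  o = IsLocalMinimizer <-> local_minimizer g (B *m xbar).
Proof.
move=> eta0_gt0 epsx picks wgen; rewrite /algorithm.
have [Kxbar _] := epsx; case: ifP => [lt [<-]|/negbT].
  have : ~ argmin (B *m xbar) xbar by move=> /lin_minE E; rewrite E ltxx in lt.
  by move=> /(reject_correct epsx); split.
rewrite -leNgt => xle /while_loop_Some[k E].
have ux : argmin (B *m xbar) xbar.
  by apply/argminE; split=> //; apply/eqP; rewrite eq_le xle lin_min_le.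
have [kp km] := picks k.
case: o E => E; last first.
  by have := loop_body_not_local_min kp.1 km.1 E; split.
split=> // _; apply: equal_slopes_local_min ux _ kp km _ => //; last first.
  exact: loop_body_local_min E.
move=> i j /eqP; rewrite dotZl mulf_eq0 => /orP[|/eqP/wgen//].
by rewrite gt_eqF // divr_gt0 // exprn_gt0.
Qed.

(** * Termination of the loop *)

Lemma lambda_gt0 u : (0 < lambda c B v u)%E.
Proof.
apply/edist_to_gt0/nbhs_enorm; have [e e0 ue] := near_cells u.
by exists e => // u' /ue uu' [j /= Nj /uu'].
Qed.

Lemma zeta_gt0 i u : (C i)° u -> (0 < zeta c B v i u)%E.
Proof.
move=> Ciu; apply: mule_gt0; first by rewrite lte_fin invr_gt0.
apply: edist_to_gt0; move/nbhs_interior: Ciu.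
by apply: (filterS (F := nbhs u)) => y Ciy [_].
Qed.

(** Within distance [lambda] of [u] every active cell contains [u]. *)
Lemma iteration_in_lambda u w (eta : R) xp : enorm w = 1 -> 0 <= eta ->
  (eta%:E < lambda c B v u)%E ->
  argmin (u + eta *: w) xp -> argmin u xp.
Proof.
move=> w1 eta_ge0 ul; apply: argmin_mono => i Ci'; apply: contrapT => NCi.
have : ((enorm (u - (u + eta *: w)))%:E < lambda c B v u)%E.
  by rewrite opprD addNKr enormN enormZ w1 mulr1 ger0_norm.
by move=> /edist_to_gt; apply; exists i.
Qed.

Lemma iteration_in_zeta i u w (eta : R) xp : (C i)° u -> enorm w = 1 ->
  0 <= eta -> (eta%:E <= zeta c B v i u)%E ->
  argmin (u + eta *: w) xp -> B *m xp = B *m v i.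
Proof.
move=> Ciu w1 eta_ge0 uz; apply: interior_cell_slope.
apply: dist_bd_interior => //; first exact: cell_closed.
have : (0 < zeta c B v i u)%E by exact: zeta_gt0.
(* The distance to the boundary exceeds its half [zeta], being positive. *)
move: uz; rewrite /zeta; case: edist_to => [d| |].
- by rewrite -EFinM !lee_fin !lte_fin; lra.
- by rewrite ltry.
- by rewrite mulrNy gtr0_sg ?invr_gt0 // mul1e.
Qed.

Section Termination.
Variables (eta0 : R) (xbar : 'cV[R]_n) (w : 'cV[R]_r).
Variables (xp xm : nat -> 'cV[R]_n).
Hypotheses (eta0_gt0 : 0 < eta0) (w1 : unit_sphere w).
Hypothesis picks : valid_picks K c B eta0 (B *m xbar) w xp xm.
Let ubar := B *m xbar.

Let ubarB (eta : R) : ubar - eta *: w = ubar + eta *: (- w).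
Proof. by rewrite scalerN. Qed.

Let Nw1 : enorm (- w) = 1. Proof. by rewrite enormN. Qed.

Lemma terminates_zeta i : (C i)° ubar ->
  terminates_within K c B xbar xp xm
    (maxe 0 (ceil_log2_div eta0 (zeta c B v i ubar)) + 1)%E.
Proof.
move=> Ci; have [N [-> Nz]] := halving_count eta0_gt0 (zeta_gt0 Ci).
exists N.+1; split; first by rewrite -EFinD lee_fin -natr1.
have eta_ge0 : 0 <= eta0 / 2 ^+ N by rewrite divr_ge0 ?exprn_ge0 // ltW.
have [kp km] := picks N; rewrite -/ubar ubarB in km.
have [|o] := @loop_body_stops ubar (xp N) (xm N); last exact: algorithm_stops.
left; rewrite (iteration_in_zeta Ci w1 eta_ge0 Nz kp).
by rewrite (iteration_in_zeta Ci Nw1 eta_ge0 Nz km).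
Qed.

(** The second extra iteration makes the step strictly smaller than [lambda]:
    the halving count only gives a weak inequality. *)
Lemma terminates_lambda : terminates_within K c B xbar xp xm
    (maxe 0 (ceil_log2_div eta0 (lambda c B v ubar)) + 2%:E)%E.
Proof.
have [N [-> Nl]] := halving_count eta0_gt0 (lambda_gt0 ubar).
exists N.+2; split; first by rewrite -EFinD lee_fin -addn2 natrD.
have eta_ge0 : 0 <= eta0 / 2 ^+ N.+1 by rewrite divr_ge0 ?exprn_ge0 // ltW.
have {}Nl : ((eta0 / 2 ^+ N.+1)%:E < lambda c B v ubar)%E.
  apply: lt_le_trans Nl; rewrite lte_fin ltr_pM2l //.
  rewrite ltf_pV2 ?posrE ?exprn_gt0 //.
  by rewrite ltr_eXn2l // ltr1n.
have [kp km] := picks N.+1; rewrite -/ubar ubarB in km.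
have [|o] := @loop_body_stops ubar (xp N.+1) (xm N.+1).
  right; split; first exact: (iteration_in_lambda w1 eta_ge0 Nl kp).
  exact: (iteration_in_lambda Nw1 eta_ge0 Nl km).
exact: algorithm_stops.
Qed.

End Termination.

(** * Clarke critical points *)

Lemma g0E u : g u = 2^-1 * dot u u + f u.
Proof. by rewrite /g0 enorm_sqr. Qed.

(** The Clarke derivative is a limit superior, so one family of difference
    quotients suffices: those between [u - t v'] and [u]. Bounding
    [f (u - t v')] by the cost of [x] there, each quotient is at least
    [- t |v'|^2 / 2]. *)
Lemma argmin_clarke_critical u x : argmin u x -> B *m x = u ->
  clarke_critical g u.
Proof.
move=> ux xu v'; rewrite -(scale0r 0) dotZl mul0r.
apply: le_ereal_inf_tmp => _ [A [[P Q] /= [uP Q0] PQ] <-].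
have [d d0 dP] := (nbhs_enorm _ _).1 uP.
have [d' d'0 d'Q] := (at_right0P _).1 Q0.
apply/lee_subgt0Pr => e e0; rewrite sub0e.
have a0 := enorm_ge0 v'; have q0 := dot_ge0 v'.
pose m := Num.min e (Num.min d d').
have m0 : 0 < m by rewrite !lt_min e0 d0 d'0.
(* [t (1 + |v'| + |v'|^2) = m / 2] makes [t], [t |v'|] and [t |v'|^2] small. *)
pose D := 2 * (1 + enorm v' + dot v' v').
have D0 : 0 < D by rewrite /D; lra.
pose t := m / D; have t0 : 0 < t by rewrite divr_gt0.
have tD : t * D = m by rewrite divfK // gt_eqF.
have ta : 0 <= t * enorm v' by rewrite mulr_ge0 // ltW.
have tq : 0 <= t * dot v' v' by rewrite mulr_ge0 // ltW.
have [me md md'] : [/\ m <= e, m <= d & m <= d'].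
  by rewrite /m !ge_min !lexx !orbT.
rewrite /D !mulrDr in tD.
apply: le_ereal_sup_tmp; eexists.
  exists (u - t *: v', t) => //; apply: PQ; split=> /=.
    by apply: dP; rewrite opprB addrC subrK enormZ gtr0_norm //; lra.
  by apply: d'Q => //; lra.
rewrite /= subrK lee_fin ler_pdivlMr //.
have := lin_min_le (u - t *: v') ux.1.
rewrite lin_costD xu !g0E (lin_minE ux) !dot_lin (dotC v' u) => le.
have tte : t * (t * dot v' v') <= t * e by rewrite ler_pM2l //; lra.
have te0 : 0 < t * e by rewrite mulr_gt0.
lra.
Qed.

(** For [y] near [u], a cell [i] active at [y] is active at [u], and [f]
    increases from [y] to [y + t w] by at most the increment [- t k] of
    [l_i]. *)
Lemma clarke_derivative_le u w (k : R) :
    (forall i, C i u -> dot w (B *m v i) = k) ->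
  (clarke_derivative g u w <= (dot u w - k)%:E)%E.
Proof.
move=> uk; apply/lee_addgt0Pr => e e0.
pose P : set 'cV[R]_r :=
  [set y | (forall i, C i y -> C i u) /\ dot y w < dot u w + e / 2].
have q0 := dot_ge0 w; pose d := e / (1 + dot w w).
have d0 : 0 < d by rewrite divr_gt0 //; lra.
have dE : d * (1 + dot w w) = e by rewrite divfK // gt_eqF //; lra.
pose Q : set R := [set t | 0 < t < d / 2].
have uP : nbhs u P.
  apply: filterI.
    by apply/nbhs_enorm; have [e' ? ?] := near_cells u; exists e'.
  have : dot y w @[y --> u] --> dot u w.
    exact: (@dot_cvg _ _ _ (nbhs u) _ id (fun _ => w) u w (fun D uD => uD)
      (@cvg_cst _ w _ (nbhs u) _)).
  by move=> /cvgr_lt /(_ (dot u w + e / 2)); apply; lra.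
have Q0 : (0 : R)^'+ Q.
  by apply/at_right0P; exists (d / 2) => /= [|t t0 td]; [lra | apply/andP].
apply: ge_ereal_inf; eexists.
  by exists [set p | P p.1 /\ Q p.2] => //; exists (P, Q).
apply: ge_ereal_sup => _ [[y t] /= [[yu yw] /andP[t0 td]] <-].
rewrite -EFinD lee_fin ler_pdivrMr //.
have [i Cy] := cell_cover y; have Ci := yu _ Cy.
have := lin_min_le (y + t *: w) (vK i).
rewrite lin_costD dotZl (uk _ Ci) !g0E (lin_min_cell Cy).
rewrite !dot_lin (dotC w y) => le.
have : t * dot y w <= t * (dot u w + e / 2) by rewrite ler_pM2l // ltW.
have : t * (t * dot w w) <= t * (d / 2 * dot w w).
  by rewrite ler_pM2l // ler_wpM2r // ltW.
have : t * (d * (1 + dot w w)) = t * e by rewrite dE.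
have : 0 <= t * d by rewrite mulr_ge0 // ltW.
have : 0 < t * e by rewrite mulr_gt0.
lra.
Qed.

(** Set [d = u' - u]. The number [d . p_i = l_i u - l_i u'] does not depend on
    the active cell [i]; call it [k]. Criticality at [u] in the direction [d]
    gives [k <= u . d], and at [u'] in the direction [- d] gives [u' . d <= k].
    Hence [d . d <= 0]. *)
Lemma clarke_critical_inj u u' : clarke_critical g u -> clarke_critical g u' ->
  (forall i, C i u <-> C i u') -> u = u'.
Proof.
move=> cu cu' uu'; pose k := f u - f u'.
have kE i : C i u -> dot (u' - u) (B *m v i) = k.
  move=> Ci; rewrite /k (lin_min_cell Ci) (lin_min_cell ((uu' i).1 Ci)).
  by rewrite !lin_costE dotDl dotNl; lra.
have kE' i : C i u' -> dot (- (u' - u)) (B *m v i) = - k.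
  by move=> /(uu' i).2/kE; rewrite dotNl => ->.
have := le_trans (cu _) (clarke_derivative_le kE).
have := le_trans (cu' _) (clarke_derivative_le kE').
rewrite -(scale0r 0) !dotZl !mul0r !lee_fin => le1 le2.
apply/esym/eqP; rewrite -subr_eq0; apply/eqP/dot_le0; move: le1 le2.
by rewrite !dot_lin; lra.
Qed.

Lemma finite_clarke_critical : finite_set (clarke_critical g).
Proof.
pose cells (u : 'cV[R]_r) := [set i | `[< C i u >]]%SET.
pose crit (T : {set 'I_V}) :=
  xget 0 [set u | clarke_critical g u /\ cells u = T].
apply: sub_finite_set (finite_image crit (@finite_finset _ setT)) => u cu.
exists (cells u) => //; rewrite /crit.
case: xgetP => [u' _ [cu' uu']|]; last first.
  by move=> /(_ u) []; split.
apply: clarke_critical_inj => // i; move/setP: uu' => /(_ i); rewrite !inE.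
by move=> E; split=> Ci; apply/asboolP; [rewrite -E | rewrite E]; apply/asboolP.
Qed.

(** * The bound that is uniform in the input *)

Section UniformBound.
Variable eta0 : R.
Hypothesis eta0_gt0 : 0 < eta0.
Local Notation bound := (uniform_iteration_bound K c B v eta0).

Let int_term (i : 'I_V) : \bar R :=
  (maxe 0 (ereal_sup [set ceil_log2_div eta0 (zeta c B v i u) |
                       u in clarke_critical g `&` (C i)°]) + 1)%E.
Let bd_term (i : 'I_V) : \bar R :=
  (maxe 0 (ereal_sup [set ceil_log2_div eta0 (lambda c B v u) |
                       u in clarke_critical g `&` bd (C i)]) + 2%:E)%E.

Lemma int_term_le i : (int_term i <= bound)%E.
Proof. by apply: le_trans (le_bigmax _ _ i); rewrite /= le_max lexx. Qed.

Lemma bd_term_le i : (bd_term i <= bound)%E.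
Proof. by apply: le_trans (le_bigmax _ _ i); rewrite /= le_max lexx orbT. Qed.

Lemma uniform_iteration_bound_lty : (bound < +oo)%E.
Proof.
apply/bigmax_ltP; split=> // i _.
have term_lty (d : 'cV[R]_r -> \bar R) (D : set 'cV[R]_r) (k : R) :
    (forall u, D u -> 0 < d u)%E ->
  (maxe 0 (ereal_sup [set ceil_log2_div eta0 (d u) |
                      u in clarke_critical g `&` D]) + k%:E < +oo)%E.
  move=> d0; apply: lte_add_pinfty; rewrite ?ltry // gt_max ltry /=.
  apply: finite_ereal_sup_lty.
    exact/finite_image/finite_setIl/finite_clarke_critical.
  by move=> _ [u [_ Du] <-]; apply/ceil_log2_div_lty/d0.
rewrite gt_max; apply/andP; split; apply: term_lty => u.
  exact: zeta_gt0.
by move=> _; exact: lambda_gt0.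
Qed.

Lemma terminates_within_le (xbar : 'cV[R]_n) xp xm (b b' : \bar R) :
  (b <= b')%E -> terminates_within K c B xbar xp xm b ->
  terminates_within K c B xbar xp xm b'.
Proof. by move=> bb' [N [Nb E]]; exists N; split=> //; apply: le_trans bb'. Qed.

Lemma terminates_uniform (xbar : 'cV[R]_n) (w : 'cV[R]_r) xp xm : K xbar ->
  unit_sphere w -> valid_picks K c B eta0 (B *m xbar) w xp xm ->
  terminates_within K c B xbar xp xm bound.
Proof.
move=> Kxbar w1 picks; have [i Ci] := cell_cover (B *m xbar).
have [rej|] := ltP (f (B *m xbar)) (lin_cost c B (B *m xbar) xbar).
  exists 0%N; split; last by rewrite /algorithm rej; eexists.
  apply: le_trans (int_term_le i); apply: adde_ge0 => //.
  by rewrite le_max lexx.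
move=> xle.
have crit : clarke_critical g (B *m xbar).
  apply: (@argmin_clarke_critical _ xbar) => //; apply/argminE; split=> //.
  by apply/eqP; rewrite eq_le xle lin_min_le.
have [Cint|NCint] := pselect ((C i)° (B *m xbar)).
  apply: terminates_within_le (terminates_zeta eta0_gt0 w1 picks Cint).
  apply: le_trans (int_term_le i); apply: leeD => //.
  rewrite ge_max le_max lexx /= le_max; apply/orP; right.
  by apply: ereal_sup_ubound; exists (B *m xbar).
apply: terminates_within_le (terminates_lambda eta0_gt0 w1 picks).
apply: le_trans (bd_term_le i); apply: leeD => //.
rewrite ge_max le_max lexx /= le_max; apply/orP; right.
apply: ereal_sup_ubound; exists (B *m xbar) => //; split=> //; split=> //.
exact: subset_closure.
Qed.

End UniformBound.

End Cells.

(** * Hyperplanes are null for the uniform distribution on the sphere *)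

(** The reflection that exchanges [a] and [b]. *)
Lemma orthogonal_image (R : realType) (r : nat) (a b : 'cV[R]_r) :
  dot a a = dot b b ->
  exists2 Q : 'M[R]_r, Q^T *m Q = 1%:M & forall w, dot a (Q *m w) = dot b w.
Proof.
move=> ab; have [->|neq] := eqVneq a b.
  by exists 1%:M => [|w]; rewrite ?trmx1 mul1mx.
pose s := a - b; pose k := 2 / dot s s.
have s0 : dot s s != 0 by rewrite dot_eq0 subr_eq0.
have ks : k * dot s s = 2 by rewrite divfK.
pose Q := 1%:M - k *: (s *m s^T).
have Qt : Q^T = Q by rewrite /Q linearB linearZ /= trmx_mul trmxK trmx1.
have ss : s^T *m s = (dot s s)%:M.
  by apply/matrixP => i j; rewrite !ord1 dotE !mxE eqxx mulr1n.
exists Q.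
  rewrite Qt {1}/Q mulmxBl mul1mx -scalemxAl -mulmxA.
  suff -> : s^T *m Q = - s^T.
    by rewrite mulmxN scalerN opprK /Q subrK.
  rewrite /Q mulmxBr mulmx1 -scalemxAr mulmxA ss mul_scalar_mx scalerA ks.
  by rewrite scaler_nat mulr2n opprD addrA subrr sub0r.
move=> w; rewrite -dot_mulmx Qt /Q mulmxBl mul1mx -scalemxAl -mulmxA.
have -> : s^T *m a = (dot s a)%:M.
  by apply/matrixP => i j; rewrite !ord1 dotE !mxE eqxx mulr1n.
rewrite mul_mx_scalar scalerA.
have -> : k * dot s a = 1.
  have : dot s s = 2 * dot s a.
    by rewrite /s !dot_lin -ab (dotC b a); ring.
  move=> E; have : k * (2 * dot s a) = 2 by rewrite -E.
  lra.
by rewrite scale1r /s subKr.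
Qed.

Section MomentCurve.
Variables (R : realType) (r : nat).

Definition moment (t : nat) : 'cV[R]_r := \col_i t%:R ^+ i.

(** The coordinates of [w] are the coefficients of a nonzero polynomial whose
    value at [t] is [dot (moment t) w]. *)
Lemma moment_hyperplanes (w : 'cV[R]_r) (N : nat) : w != 0 ->
  (\sum_(t < N) (dot (moment t) w == 0%R) <= r)%N.
Proof.
move=> w0; pose p := rVpoly w^T.
have coefp (i : 'I_r) : p`_i = w i 0 by rewrite coef_rVpoly_ord mxE.
have pE t : dot (moment t) w = p.[t%:R].
  rewrite (@horner_coef_wide _ r) ?size_poly //; apply: eq_bigr => i _.
  by rewrite coefp mxE mulrC.
have p0 : p != 0.
  apply: contra_neq w0 => p0; apply/matrixP => i j.
  by rewrite ord1 mxE -coefp p0 coef0.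
pose rs := [seq t%:R : R | t <- iota 0 N & dot (moment t) w == 0].
have rsroot : all (root p) rs.
  by apply/allP => y /mapP[t]; rewrite mem_filter pE => /andP[pt _] ->.
have rsuniq : uniq rs.
  rewrite map_inj_uniq; first by rewrite filter_uniq ?iota_uniq.
  by move=> x y xy; apply/eqP; rewrite -(eqr_nat R); apply/eqP.
have := max_poly_roots p0 rsroot rsuniq; rewrite size_map size_filter => lt.
apply: leq_trans (ltnW (leq_trans lt (size_poly _ _))).
rewrite -sum1_count -[X in iota 0 X]subn0 -/(index_iota 0 N) big_mkord.
by rewrite [leqRHS]big_mkcond; apply: leq_sum => i _; case: ifP.
Qed.

End MomentCurve.

Section UniformSphere.
Variables (R : realType) (r : nat) (P : probability (borel_cV R r) R).
Hypothesis P_unif : uniform_on_sphere P.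
Implicit Types (h m : 'cV[R]_r).

Local Notation S := (@unit_sphere R r : set (borel_cV R r)).
Let H h : set 'cV[R]_r := [set w | dot h w = 0].

Lemma level_measurable (F : 'cV[R]_r -> R) (a : R) : continuous F ->
  measurable ([set w | F w = a] : set (borel_cV R r)).
Proof.
move=> Fc; rewrite -[X in measurable X]setCK; apply: measurableC.
apply: sub_sigma_algebra; apply: closed_openC.
rewrite (_ : [set w | _] = F @^-1` [set a]) //.
by apply: closed_comp => [w _|]; [exact: Fc | exact: closed_eq].
Qed.

Lemma hyperplane_measurable h : measurable (H h : set (borel_cV R r)).
Proof.
apply: level_measurable => w.
exact: (@dot_cvg _ _ _ (nbhs w) _ (fun _ => h) id h w
  (@cvg_cst _ h _ (nbhs w) _) (fun D wD => wD)).
Qed.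

Lemma sphere_measurable : measurable S.
Proof.
apply: level_measurable => w.
exact: (@enorm_cvg _ _ _ (nbhs w) _ id w (fun D wD => wD)).
Qed.

(** A reflection maps one hyperplane to the other, once the normals are scaled
    to the same length. *)
Lemma hyperplane_prob_eq h m : h != 0 -> m != 0 -> P (H h) = P (H m).
Proof.
move=> h0 m0.
have m_gt0 : 0 < enorm m by rewrite sqrtr_gt0 lt_def dot_eq0 m0 dot_ge0.
have h_gt0 : 0 < enorm h by rewrite sqrtr_gt0 lt_def dot_eq0 h0 dot_ge0.
pose k := enorm h / enorm m; have k0 : k != 0 by rewrite gt_eqF // divr_gt0.
have hm : dot h h = dot (k *: m) (k *: m).
  by rewrite !dot_lin -!enorm_sqr mulrA -expr2 -exprMn divfK // gt_eqF.
have [Q Qorth Qh] := orthogonal_image hm.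
have [_ /(_ Q _ Qorth (hyperplane_measurable h)) <-] := P_unif.
congr (P _); apply/seteqP; split=> w; rewrite /H /= Qh dotZl.
  by move=> /eqP; rewrite mulf_eq0 (negbTE k0) => /eqP.
by move=> ->; rewrite mulr0.
Qed.

Lemma hyperplane_prob_sphere h : P (H h `&` S) = P (H h).
Proof.
have mS := sphere_measurable; have mH := hyperplane_measurable h.
have E : P (H h) = (P (H h `\` S) + P (H h `&` S))%E by exact: measureDI.
have NS : P (~` S) = 0%E.
  by rewrite probability_setC // P_unif.1 subee.
suff HS : P (H h `\` S) = 0%E by rewrite E HS add0e.
apply/eqP; rewrite -measure_le0 -NS.
apply: le_measure; rewrite ?inE; last by move=> w [].
  exact: measurableD.
exact: measurableC.
Qed.

(** Summing the probabilities of [N] of the hyperplanes of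
    [moment_hyperplanes] is integrating a count bounded by [r]. *)
Lemma hyperplane_null h : h != 0 -> P (H h) = 0%E.
Proof.
move=> h0.
have r0 : (0 < r)%N.
  rewrite lt0n; apply: contra_neq h0 => r0; apply/matrixP => i.
  by have := ltn_ord i; rewrite {2}r0.
have moment0 t : moment R r t != 0.
  apply/eqP => /matrixP/(_ (Ordinal r0) 0); rewrite !mxE expr0 => /eqP.
  by rewrite oner_eq0.
have mS := sphere_measurable.
have mH t := hyperplane_measurable (moment R r t).
have le N : (N%:R%:E * P (H h) <= r%:R%:E)%E.
  have <- : (\sum_(t < N) P (H (moment R r t) `&` S) = N%:R%:E * P (H h))%E.
    under eq_bigr => t _ do
      rewrite hyperplane_prob_sphere (hyperplane_prob_eq (moment0 t) h0).
    by rewrite sumr_const card_ord mule_natl.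
  under eq_bigr => t _ do rewrite -(integral_indic _ mS (mH t)).
  have mI (t : 'I_N) : measurable_fun S
      (EFin \o (\1_(H (moment R r t)) : borel_cV R r -> R)).
    by apply/measurable_EFinP; apply: measurable_indic.
  rewrite -(@ge0_integral_sum _ _ _ P S mS _
    (fun (t : 'I_N) w => (\1_(H (moment R r t)) w)%:E) mI); last first.
    by move=> t w _; rewrite lee_fin.
  have <- : (\int[P]_(w in S) (cst (r%:R%:E : \bar R) w) = r%:R%:E)%E.
    have PS : P S = 1%E := P_unif.1.
    transitivity (r%:R%:E * P S)%E; [exact: integral_cst | by rewrite PS mule1].
  apply: ge0_le_integral => //.
  - by move=> w _; apply: sume_ge0 => t _; rewrite lee_fin.
  - exact: emeasurable_sum.
  - move=> w w1; have w0 : w != 0 :> 'cV[R]_r.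
      apply/eqP => w0; have := w1 : enorm (w : 'cV[R]_r) = 1.
      by rewrite w0 /enorm dot0r sqrtr0 => /eqP; rewrite eq_sym oner_eq0.
    rewrite sumEFin lee_fin /=; under eq_bigr => t _ do rewrite indicE.
    rewrite -natr_sum ler_nat.
    apply: leq_trans (moment_hyperplanes N w0); apply: leq_sum => t _.
    suff -> : (w \in H (moment R r t)) = (dot (moment R r t) w == 0) by [].
    by apply/idP/eqP; rewrite inE.
have fin : P (H h) \is a fin_num.
  by rewrite fin_num_measure //; exact: hyperplane_measurable.
move: le; rewrite -(fineK fin) => le; congr EFin.
have p0 : 0 <= fine (P (H h)) by rewrite fine_ge0.
apply/eqP; rewrite eq_le p0 andbT leNgt; apply/negP => p_gt0.
have := le (Num.truncn (r%:R / fine (P (H h)))).+1.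
by rewrite -EFinM lee_fin leNgt -ltr_pdivrMr // truncnS_gt.
Qed.

Lemma hyperplane_ae h : h != 0 -> {ae P, forall w, dot h w != 0}.
Proof.
move=> h0; exists (H h); split; first exact: hyperplane_measurable.
  exact: hyperplane_null.
by move=> w /= /negP; rewrite negbK => /eqP.
Qed.

End UniformSphere.

(** * Certification of local minimizers *)

Unset Implicit Arguments.
Set Strict Implicit.
Set Printing Implicit Defensive.

Theorem proposition4 (R : realType) (m n r V : nat)
    (A : 'M[R]_(m, n)) (b : 'cV[R]_m) (c : 'cV[R]_n)
    (M : 'M[R]_n) (B : 'M[R]_(r, n)) (v : 'I_V -> 'cV[R]_n)
    (M_sym : M^T = M)
    (M_psd : forall x : 'cV[R]_n, 0 <= dot x (M *m x))
    (M_fact : M = B^T *m B)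
    (r_le_n : (r <= n)%N)
    (K_nonempty : polyhedron A b !=set0)
    (K_bounded : bounded_set (polyhedron A b))
    (q_nonconstant : exists x y : 'cV[R]_n,
       [/\ polyhedron A b x, polyhedron A b y &
        - 2^-1 * dot x (M *m x) + dot c x
          != - 2^-1 * dot y (M *m y) + dot c y])
    (v_inj : injective v)
    (v_vertices : range v = vertices (polyhedron A b)) :
  let K := polyhedron A b in
  let C := cell c B v in
  [/\ forall (ueps : 'cV[R]_r) (eta0 : R) (xbar : 'cV[R]_n),
        0 < eta0 -> lin_argmin K c B ueps xbar ->
        let ubar := B *m xbar in
        [/\ forall P : probability (borel_cV R r) R, uniform_on_sphere P ->
              {ae P, forall w : 'cV[R]_r, unit_sphere w ->
                 forall xp xm, valid_picks K c B eta0 ubar w xp xm ->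
                 returns_correctly K c B xbar xp xm},
            forall i : 'I_V, (C i)° ubar ->
              forall (w : 'cV[R]_r) xp xm, unit_sphere w ->
              valid_picks K c B eta0 ubar w xp xm ->
              terminates_within K c B xbar xp xm
                (maxe 0 (ceil_log2_div eta0 (zeta c B v i ubar)) + 1)%E
          & forall i : 'I_V, bd (C i) ubar ->
              forall (w : 'cV[R]_r) xp xm, unit_sphere w ->
              valid_picks K c B eta0 ubar w xp xm ->
              terminates_within K c B xbar xp xm
                (maxe 0 (ceil_log2_div eta0 (lambda c B v ubar)) + 2%:E)%E],
      finite_set (clarke_critical (g0 K c B))
    & forall eta0 : R, 0 < eta0 ->
        (uniform_iteration_bound K c B v eta0 < +oo)%E /\
        forall (ueps : 'cV[R]_r) (xbar : 'cV[R]_n) (w : 'cV[R]_r) xp xm,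
          lin_argmin K c B ueps xbar -> unit_sphere w ->
          valid_picks K c B eta0 (B *m xbar) w xp xm ->
          terminates_within K c B xbar xp xm
            (uniform_iteration_bound K c B v eta0)].
Proof.
move=> K C.
have vK i : K (v i).
  by have [] : vertices K (v i) by rewrite -v_vertices; exists i.
have v_le u x : K x -> exists i, lin_cost c B u (v i) <= lin_cost c B u x.
  move=> /(polyhedron_vertex_le K_bounded (c - B^T *m u))[y].
  by rewrite -v_vertices => -[i _ <-]; exists i.
split; last 1 first.
- move=> eta0 eta0_gt0; split.
    exact: (uniform_iteration_bound_lty K_nonempty vK v_le eta0_gt0).
  by move=> ueps xbar w xp xm [Kxbar _]; apply: terminates_uniform.
- move=> ueps eta0 xbar eta0_gt0 epsx ubar; split; last 1 first.
  + move=> i _ w xp xm w1 picks.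
    exact: (terminates_lambda K_nonempty vK v_le eta0_gt0 w1 picks).
  + move=> P P_unif.
    have generic : {ae P, forall w : 'cV[R]_r, forall i j,
        dot w (B *m v i - B *m v j) = 0 -> B *m v i = B *m v j}.
      apply: (@filter_forall _ _ _ (almost_everywhere P)) => i.
      apply: (@filter_forall _ _ _ (almost_everywhere P)) => j.
      have [ij|ij] := eqVneq (B *m v i) (B *m v j).
        exact: (nearW (F := almost_everywhere P)).
      have := hyperplane_ae P_unif (h := B *m v i - B *m v j).
      rewrite subr_eq0 => /(_ ij).
      apply: (filterS (F := almost_everywhere P)) => w /eqP wij /esym.
      by rewrite dotC => /esym.
    apply: (filterS (F := almost_everywhere P) _ generic).
    move=> w wgen w1 xp xm picks.
    have [N [_ [vd E]]] :=
      terminates_lambda K_nonempty vK v_le eta0_gt0 w1 picks.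
    exists N, vd; split=> //.
    exact: (algorithm_correct K_nonempty vK v_le eta0_gt0 epsx picks wgen E).
  + move=> i Ci w xp xm w1 picks.
    exact: (terminates_zeta K_nonempty vK v_le eta0_gt0 w1 picks Ci).
- exact: (finite_clarke_critical K_nonempty vK v_le).
Qed.
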